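(* For every prime power $q\ge 4$ there exists a set of $q^2-q$ points of $\mathrm{AG}(5,q)$ that is both a $4$-general set and a $(5,3)$-set.
   Context: For integers $r,s$, an $(r,s)$-set of $\mathrm{PG}(n,q)$ is a set $\mathcal X$ of points such that: (i) every $s$-dimensional projective subspace contains at most $r$ points of $\mathcal X$; (ii) $\mathcal X$ spans $\mathrm{PG}(n,q)$; (iii) some $(s+1)$-dimensional projective subspace contains $r+2$ points of $\mathcal X$. A $k$-general set is a $(k-1,k-2)$-set (so a $4$-general set is a $(3,2)$-set). A set of points of $\mathrm{AG}(n,q)$ is called an $(r,s)$-set (resp. $k$-general set) of $\mathrm{AG}(n,q)$ if, regarded as a subset of $\mathrm{PG}(n,q)=\mathrm{AG}(n,q)\cup H_\infty$ ($H_\infty$ the hyperplane at infinity), it is an $(r,s)$-set (resp. $k$-general set) of $\mathrm{PG}(n,q)$. *)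

(* Defs.v *)
From HB Require Import structures.
From mathcomp Require Import all_boot all_order all_algebra all_field.
Set Implicit Arguments. Unset Strict Implicit. Unset Printing Implicit Defensive.
Import GRing.Theory.
Local Open Scope ring_scope.

(* PG(n,q) is modelled on F^(1+n), F a finite field with #|F| = q:
   projective points are 1-dimensional subspaces, a projective subspace of
   dimension s is a vector subspace of dimension s+1, represented by the row
   space of a square matrix U with \rank U = s+1.
   AG(n,q) = F^n embeds into PG(n,q) via v |-> <(1, v)>, whose complement is
   the hyperplane at infinity x_0 = 0. *)

Section PG.
Variable F : finFieldType.
Variable n : nat.

Definition hom (v : 'rV[F]_n) : 'rV[F]_(1 + n) := row_mx (const_mx 1) v.

Definition npts_on (X : {set 'rV[F]_n}) (U : 'M[F]_(1 + n)) : nat :=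
  #|[set x in X | (hom x <= U)%MS]|.

Definition rs_set (r s : nat) (X : {set 'rV[F]_n}) : Prop :=
  [/\
      (forall U : 'M[F]_(1 + n), \rank U = s.+1 -> (npts_on X U <= r)%N),
      (forall U : 'M[F]_(1 + n),
          (forall x, x \in X -> (hom x <= U)%MS) -> \rank U = (1 + n)%N) &
      (exists U : 'M[F]_(1 + n), \rank U = s.+2 /\ (r.+2 <= npts_on X U)%N)].

Definition k_general_set (k : nat) (X : {set 'rV[F]_n}) : Prop :=
  rs_set k.-1 k.-2 X.

End PG.

(* Main.v *)
Require Import Defs.
From mathcomp Require Import all_boot all_order all_algebra all_field.
From mathcomp Require Import ring zify.
Set Implicit Arguments. Unset Strict Implicit. Unset Printing Implicit Defensive.
Import GRing.Theory.
Local Open Scope ring_scope.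

(* The set is the affine part of a quintic del Pezzo surface: the elliptic
   quadric a y = b^2 + b + c of AG(3,q) (q^2 - q affine points, conic
   (1 : z : z^2) at infinity), embedded by the quadrics through three conjugate
   points of that conic, the roots of an irreducible cubic
   kappa = z^3 + k2 z^2 + k1 z + k0.  The two new coordinates f0, f1 restrict to
   kappa and z kappa on the conic at infinity.

   Suppose the weights w_i give a linear relation between points of the set.
   Its quadratic moments define a functional on quartics in z that kills kappa
   and z kappa.
   - If the points lie in a plane of AG(3,q), it also kills psi, z psi, z^2 psi,
     where psi of degree <= 2 is the trace of the plane at infinity.  As psi and
     kappa are coprime, all quadratic moments vanish, and products of two planes
     separate five points since no three of them are collinear.  Four dependent
     points are coplanar, so this settles planes.
   - If six non-coplanar points lie in a solid, then f0 and f1 are affine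
     functions on them, and the syzygy between kappa and z kappa yields two more
     quadratic relations, with leading terms g and z g where g is nonzero of
     degree <= 2.  One more linear condition on the weights gives z^2 g, so the
     quadratic moments vanish, then the cubic ones, and products of three planes
     separate the six points.

   A suitable choice of c and kappa puts five explicit points in a solid; since
   q^2 - q - 5 > q + 1, some hyperplane through that solid has two more. *)

(** * Apolarity *)

Section Apolarity.
Variable F : fieldType.
Implicit Types k g h : F.

Lemma size_Poly4 k0 k1 k2 : size (Poly [:: k0; k1; k2; 1]) = 4%N.
Proof. by rewrite (@PolyK _ 0) //= oner_neq0. Qed.

(** The [h_i] are the values of a functional on 1, z, ..., z^4 that kills K, z K, G, z G and z^2 G.
    The rootless cubic K is irreducible, hence coprime to the nonzero G of degree at most 2, so
    these five products span all polynomials of degree at most 4. *)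
Lemma apolar_eq0 k0 k1 k2 g0 g1 g2 h0 h1 h2 h3 h4 :
  (forall z, z ^+ 3 + k2 * z ^+ 2 + k1 * z + k0 != 0) ->
  [|| g0 != 0, g1 != 0 | g2 != 0] ->
  k0 * h0 + k1 * h1 + k2 * h2 + h3 = 0 ->
  k0 * h1 + k1 * h2 + k2 * h3 + h4 = 0 ->
  g0 * h0 + g1 * h1 + g2 * h2 = 0 ->
  g0 * h1 + g1 * h2 + g2 * h3 = 0 ->
  g0 * h2 + g1 * h3 + g2 * h4 = 0 ->
  [/\ h0 = 0, h1 = 0, h2 = 0, h3 = 0 & h4 = 0].
Proof.
move=> rootless gN0 e0 e1 d0 d1 d2.
pose K := Poly [:: k0; k1; k2; 1]; pose G := Poly [:: g0; g1; g2].
have szK : size K = 4%N := size_Poly4 _ _ _.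
have KN0 : K != 0 by rewrite -size_poly_eq0 szK.
have coefK j : K`_j = [:: k0; k1; k2; 1]`_j by rewrite coef_Poly.
have coefG j : G`_j = [:: g0; g1; g2]`_j by rewrite coef_Poly.
have szG : (size G <= 3)%N by apply: (leq_trans (size_Poly _)).
have GN0 : G != 0.
  apply: contraTneq gN0 => G0; have g_0 j : G`_j = 0 by rewrite G0 coef0.
  by move: (g_0 0) (g_0 1) (g_0 2); rewrite !coefG /= => -> -> ->; rewrite eqxx.
have irrK : irreducible_poly K.
  apply: cubic_irreducible => [|z]; first by rewrite szK.
  rewrite rootE horner_Poly /=.
  by have := rootless z; rewrite (_ : _ + k0 = (((0 * z + 1) * z + k2) * z + k1) * z + k0) //; ring.
have cop : coprimep K G.
  rewrite irreducible_poly_coprime //; apply/negP => /(dvdp_leq GN0).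
  by rewrite szK leqNgt ltnS szG.
pose T (r : {poly F}) := r`_0 * h0 + r`_1 * h1 + r`_2 * h2 + r`_3 * h3 + r`_4 * h4.
have T0 (r : {poly F}) : (size r <= 3)%N -> T r = 0.
  move=> szr; have [[u v] /= /eqpf_eq [c cN0 uv1]] := Bezout_coprimepP _ _ cop.
  have {}uv1 : (c^-1 *: u) * K + (c^-1 *: v) * G = 1.
    by rewrite -!scalerAl -scalerDr uv1 scalerA mulVf // scale1r.
  move: (c^-1 *: u) (c^-1 *: v) uv1 => {u v} u v uv1.
  (* Reducing the cofactor of [G] modulo [K] gives [v'] degree at most 2; then [u' * K = r - v' * G]
     has degree at most 4, which forces [u'] to have degree at most 1. *)
  pose v' : {poly F} := (r * v) %% K; pose u' : {poly F} := r * u + (r * v) %/ K * G.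
  have rE : r = u' * K + v' * G.
    rewrite /u' mulrDl -addrA [_ * G * K]mulrAC -mulrDl -divp_eq.
    by rewrite -!mulrA -mulrDr uv1 mulr1.
  have szv : (size v' <= 3)%N by rewrite -ltnS -szK ltn_modp.
  have szu : (size u' <= 2)%N.
    have [->|uN0] := eqVneq u' 0; first by rewrite size_poly0.
    have : (size (u' * K)%R <= 5)%N.
      rewrite (_ : u' * K = r - v' * G); last by rewrite [in RHS]rE addrK.
      apply: (leq_trans (size_polyD _ _)); rewrite geq_max size_polyN.
      rewrite (leq_trans szr) //=; apply: (leq_trans (size_polyMleq _ _)).
      by rewrite -subn1 leq_subLR; apply: (leq_add szv szG).
    by rewrite size_mul // szK addn4.
  have un j : (2 <= j)%N -> u'`_j = 0 by move=> lj; rewrite nth_default // (leq_trans szu).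
  have vn j : (3 <= j)%N -> v'`_j = 0 by move=> lj; rewrite nth_default // (leq_trans szv).
  clearbody u' v'.
  have -> : T r = u'`_0 * (k0 * h0 + k1 * h1 + k2 * h2 + h3)
      + u'`_1 * (k0 * h1 + k1 * h2 + k2 * h3 + h4)
      + v'`_0 * (g0 * h0 + g1 * h1 + g2 * h2)
      + v'`_1 * (g0 * h1 + g1 * h2 + g2 * h3)
      + v'`_2 * (g0 * h2 + g1 * h3 + g2 * h4).
    rewrite /T rE !coefD !coefM !big_ord_recr !big_ord0 /= !subnn ?subn0 ?subSS ?subn0.
    rewrite !coefK !coefG /= (un 2) // (un 3) // (un 4) // (vn 3) // (vn 4) //.
    ring.
  by rewrite e0 e1 d0 d1 d2 !mulr0 !addr0.
have h_0 : h0 = 0.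
  have := T0 1; rewrite size_poly1 => /(_ isT); rewrite /T !coef1 /= => <-; ring.
have h_1 : h1 = 0.
  have := T0 'X; rewrite size_polyX => /(_ isT); rewrite /T !coefX /= => <-; ring.
have h_2 : h2 = 0.
  have := T0 'X^2; rewrite size_polyXn => /(_ isT); rewrite /T !coefXn /= => <-; ring.
have h_3 : h3 = 0 by rewrite -e0 h_0 h_1 h_2; ring.
by split=> //; rewrite -e1 h_1 h_2 h_3; ring.
Qed.

End Apolarity.

(** * The elliptic quadric *)

Section Quadric.
Variables (F : fieldType) (c : F).
Hypothesis n_rootless : forall z : F, z ^+ 2 + z + c != 0.

Definition quadric (a b y : F) := a * y = b ^+ 2 + b + c.

Lemma quadric_a_neq0 a b y : quadric a b y -> a != 0.
Proof.
by move=> q; apply: contra_neq (n_rootless b) => a0; rewrite -q a0 mul0r.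
Qed.

Lemma quadric_y a b y y' : quadric a b y -> quadric a b y' -> y = y'.
Proof.
move=> q q'; apply: (mulfI (quadric_a_neq0 q)); by rewrite q q'.
Qed.

(* The quadric has no rational line: a line meets it in at most two points,
   and the points at infinity of the quadric are (1 : z : z^2), so a line in
   direction (1, z, z^2) through (a, b, y) would make b - a z a root of
   X^2 + X + c. *)
Lemma quadric_no_three_collinear a b y d1 d2 d3 t :
    quadric a b y -> quadric (a + d1) (b + d2) (y + d3) ->
    quadric (a + t * d1) (b + t * d2) (y + t * d3) ->
  t != 0 -> t != 1 -> d1 = 0 /\ d2 = 0.
Proof.
move=> q0 q1 qt tN0 tN1.
have p1 : a * d3 + y * d1 - b * d2 *+ 2 - d2 + (d1 * d3 - d2 ^+ 2) = 0.
  transitivity ((a + d1) * (y + d3) - ((b + d2) ^+ 2 + (b + d2) + c)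
     - (a * y - (b ^+ 2 + b + c))); first by ring.
  by rewrite q0 q1 !subrr.
have pt : a * d3 + y * d1 - b * d2 *+ 2 - d2 + t * (d1 * d3 - d2 ^+ 2) = 0.
  apply: (mulfI tN0); rewrite mulr0.
  transitivity ((a + t * d1) * (y + t * d3)
     - ((b + t * d2) ^+ 2 + (b + t * d2) + c)
     - (a * y - (b ^+ 2 + b + c))); first by ring.
  by rewrite q0 qt !subrr.
have e : d1 * d3 = d2 ^+ 2.
  apply/eqP; rewrite -subr_eq0; have : (t - 1) * (d1 * d3 - d2 ^+ 2) == 0.
    by apply/eqP; rewrite -[RHS](subrr 0) -{1}pt -p1; ring.
  by rewrite mulf_eq0 [t - 1 == 0]subr_eq0 (negPf tN1).
have [d1_0|d1N0] := eqVneq d1 0.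
  split=> //; apply/eqP; have : d2 ^+ 2 == 0 by rewrite -e d1_0 mul0r.
  by rewrite expf_eq0.
case/eqP: (n_rootless (b - a * (d2 / d1))).
have q0' : c = a * y - b ^+ 2 - b by rewrite q0; ring.
have {}p1 : a * d3 + y * d1 - b * d2 *+ 2 - d2 = 0 by rewrite -p1 e subrr addr0.
transitivity (a / d1 * (a * d3 + y * d1 - b * d2 *+ 2 - d2)
  + (a / d1) ^+ 2 * (d2 ^+ 2 - d1 * d3)).
  rewrite q0'; field; exact: d1N0.
by rewrite p1 e subrr !mulr0 addr0.
Qed.

Definition ev (l : F * F * F * F) (a b y : F) : F :=
  l.1.1.1 + l.1.1.2 * a + l.1.2 * b + l.2 * y.

(** No three points of the quadric are collinear. The last two points may coincide, which lets
    [separating_planes] treat an odd number of points. *)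
Lemma separating_plane a b y a1 b1 y1 a2 b2 y2 :
    quadric a b y -> quadric a1 b1 y1 -> quadric a2 b2 y2 ->
    (a, b) != (a1, b1) -> (a, b) != (a2, b2) ->
  exists l, [/\ ev l a1 b1 y1 = 0, ev l a2 b2 y2 = 0 & ev l a b y != 0].
Proof.
rewrite !xpair_eqE => q q1 q2 ne1 ne2.
have [/andP[/eqP ea /eqP eb]|ne] := boolP ((a1 == a2) && (b1 == b2)).
  subst a2 b2; rewrite -(quadric_y q1 q2).
  have [ea|na] := eqVneq a a1.
    exists (- b1, 0, 1, 0); rewrite /ev /=; split; [by ring|by ring|].
    rewrite ea eqxx /= in ne1; rewrite -subr_eq0 in ne1.
    by rewrite (_ : _ + _ = b - b1) //; ring.
  exists (- a1, 1, 0, 0); rewrite /ev /=; split; [by ring|by ring|].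
  rewrite -subr_eq0 in na.
  by rewrite (_ : _ + _ = a - a1) //; ring.
pose d1 := a2 - a1; pose d2 := b2 - b1; pose d3 := y2 - y1.
have neD : (d1 == 0) && (d2 == 0) = false.
  by rewrite !subr_eq0 [a2 == _]eq_sym [b2 == _]eq_sym; apply: negbTE.
(* Forms vanishing on the line joining the last two points; as (d1, d2) is nonzero, their common
   zeros are exactly that line. *)
pose l12 : F * F * F * F := (b1 * d1 - a1 * d2, d2, - d1, 0).
pose l13 : F * F * F * F := (y1 * d1 - a1 * d3, d3, 0, - d1).
pose l23 : F * F * F * F := (y1 * d2 - b1 * d3, 0, d3, - d2).
have [e12|] := eqVneq (ev l12 a b y) 0; last first.
  by exists l12; split=> //; rewrite /ev /= /d1 /d2; ring.
have [e13|] := eqVneq (ev l13 a b y) 0; last first.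
  by exists l13; split=> //; rewrite /ev /= /d1 /d3; ring.
have [e23|] := eqVneq (ev l23 a b y) 0; last first.
  by exists l23; split=> //; rewrite /ev /= /d2 /d3; ring.
exfalso.
have {}e12 : (a - a1) * d2 = (b - b1) * d1.
  by apply/eqP; rewrite -subr_eq0 -e12 /ev /=; apply/eqP; ring.
have {}e13 : (a - a1) * d3 = (y - y1) * d1.
  by apply/eqP; rewrite -subr_eq0 -e13 /ev /=; apply/eqP; ring.
have {}e23 : (b - b1) * d3 = (y - y1) * d2.
  by apply/eqP; rewrite -subr_eq0 -e23 /ev /=; apply/eqP; ring.
have [t [ta tb ty]] : exists t, [/\ a = a1 + t * d1, b = b1 + t * d2 & y = y1 + t * d3].
  have [d1_0|d1N0] := eqVneq d1 0.
    have d2N0 : d2 != 0 by move: neD; rewrite d1_0 eqxx => /= ->.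
    exists ((b - b1) / d2); split.
    - apply: (mulIf d2N0); rewrite d1_0 mulr0 addr0; apply/eqP.
      by rewrite -subr_eq0 -mulrBl e12 d1_0 mulr0.
    - by field.
    - by rewrite mulrAC e23; field.
  exists ((a - a1) / d1); split.
  - by field.
  - by rewrite mulrAC e12; field.
  - by rewrite mulrAC e13; field.
have tN0 : t != 0.
  by apply: contraNneq ne1 => t0; rewrite ta tb t0 !mul0r !addr0 !eqxx.
have tN1 : t != 1.
  apply: contraNneq ne2 => t1; rewrite ta tb t1 !mul1r /d1 /d2.
  by rewrite [a1 + _]addrC [b1 + _]addrC !subrK !eqxx.
have [||d1_0 d2_0] := @quadric_no_three_collinear a1 b1 y1 d1 d2 d3 t q1 _ _ tN0 tN1.
- by rewrite /d1 /d2 /d3 [a1 + _]addrC [b1 + _]addrC [y1 + _]addrC !subrK.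
- by rewrite -ta -tb -ty.
- by move: neD; rewrite d1_0 d2_0 eqxx.
Qed.

(** * Separation of points by products of planes, and moments of weights *)

Section Moments.
Variables (I : finType) (a b y : I -> F).
Hypothesis on_q : forall i, quadric (a i) (b i) (y i).
Hypothesis pt_inj : injective (fun i => (a i, b i)).

Definition evi l i := ev l (a i) (b i) (y i).

(** Each plane disposes of two points of [s]. *)
Lemma separating_planes d (s : seq I) i : i \notin s -> (size s <= d.*2)%N ->
  exists ls, [/\ size ls = d, \prod_(l <- ls) evi l i != 0 &
    forall j, j \in s -> \prod_(l <- ls) evi l j = 0].
Proof.
elim: d s => [|d IH] s.
  by case: s => // _ _; exists [::]; rewrite !big_nil oner_neq0.
have step j1 j2 s' : i \notin [:: j1, j2 & s'] -> (size s' <= d.*2)%N ->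
    exists ls, [/\ size ls = d.+1, \prod_(l <- ls) evi l i != 0 &
    forall j, j \in [:: j1, j2 & s'] -> \prod_(l <- ls) evi l j = 0].
  rewrite !inE !negb_or => /and3P[ij1 ij2 is'] sz.
  have [ls [szls lsi lss]] := IH s' is' sz.
  have ne j : i != j -> (a i, b i) != (a j, b j) by apply: contra => /eqP/pt_inj->.
  have [l [l1 l2 li]] :=
    separating_plane (on_q i) (on_q j1) (on_q j2) (ne _ ij1) (ne _ ij2).
  exists (l :: ls); split=> [/=||j]; first by rewrite szls.
    by rewrite big_cons mulf_neq0.
  rewrite !inE big_cons => /or3P[/eqP->|/eqP->|/lss->]; last by rewrite mulr0.
    by rewrite /evi l1 mul0r.
  by rewrite /evi l2 mul0r.
case: s => [|j1 [|j2 s']].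
(* The constant form 1, the plane at infinity, pads the product to [d.+1] factors. *)
- have [ls [szls lsi _]] := IH [::] isT isT.
  by exists ((1, 0, 0, 0) :: ls); split=> //=; rewrite ?szls // big_cons /evi /ev /= !mul0r !addr0 mul1r.
- move=> ni _; have ni' : i \notin [:: j1; j1] by move: ni; rewrite !inE negb_or andbb.
  have [ls [szls lsi lss]] := step j1 j1 [::] ni' isT.
  by exists ls; split=> // j; rewrite !inE => jj; apply: lss; rewrite !inE jj.
- by rewrite doubleS /= !ltnS; apply: step.
Qed.

Section Weights.
Variable w : I -> F.
Definition mom (f : I -> F) := \sum_i w i * f i.

(** Formal linear combinations: with [mom_comb], the vanishing of a moment reduces to a pointwise
    identity. *)
Fixpoint comb (s : seq (F * (I -> F))) (i : I) : F :=
  if s is p :: s' then p.1 * p.2 i + comb s' i else 0.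
Fixpoint mom0 (s : seq (F * (I -> F))) : Prop :=
  if s is p :: s' then mom p.2 = 0 /\ mom0 s' else True.

Lemma mom_comb s f : (forall i, f i = comb s i) -> mom0 s -> mom f = 0.
Proof.
move=> fE; rewrite /mom (eq_bigr (fun i => w i * comb s i)); last by move=> i _; rewrite fE.
elim: s {fE} => [_|[k g] s IH /= [mg /IH ms]] /=; first by rewrite big1 // => i _; rewrite mulr0.
rewrite (eq_bigr (fun i => k * (w i * g i) + w i * comb s i)); last by move=> i _; ring.
by rewrite big_split /= -mulr_sumr ms -/(mom g) mg mulr0 addr0.
Qed.

(** A product of [d] planes vanishing at the other points, at most 2d of them, but not at [i]
    isolates [w i]. *)
Lemma weights_eq0 d : (#|I| <= d.*2.+1)%N ->
  (forall ls, size ls = d -> mom (fun i => \prod_(l <- ls) evi l i) = 0) ->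
  forall i, w i = 0.
Proof.
move=> cI killed i.
have [||ls [szls lsi lss]] := @separating_planes d (enum (predC1 i)) i.
- by rewrite mem_enum !inE eqxx.
- by rewrite -cardE cardC1; case: #|I| cI.
have := killed _ szls; rewrite /mom (bigD1 i) //= [X in _ + X]big1 => [|j ji]; last first.
  by rewrite /= lss ?mulr0 // mem_enum.
by rewrite addr0 => /eqP; rewrite mulf_eq0 (negPf lsi) orbF => /eqP.
Qed.

Definition affine_mom0 :=
  [/\ mom (fun=> 1) = 0, mom a = 0, mom b = 0 & mom y = 0].
(** On the conic (1 : z : z^2) these monomials are 1, z, ..., z^4. The monomial [a y] is absent
    because it equals b^2 + b + c on the quadric. *)
Definition quad_mom0 :=
  [/\ mom (fun i => a i ^+ 2) = 0, mom (fun i => a i * b i) = 0,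
      mom (fun i => b i ^+ 2) = 0, mom (fun i => b i * y i) = 0
    & mom (fun i => y i ^+ 2) = 0].

Lemma quad_killed : affine_mom0 -> quad_mom0 ->
  forall l m, mom (fun i => evi l i * evi m i) = 0.
Proof.
case=> m1 ma mb my [maa mab mbb mby myy] [[[l0 l1] l2] l3] [[[n0 n1] n2] n3].
apply: (@mom_comb [:: (l0 * n0 + c * (l1 * n3 + l3 * n1), fun=> 1);
  (l0 * n1 + l1 * n0, a); (l0 * n2 + l2 * n0 + (l1 * n3 + l3 * n1), b);
  (l0 * n3 + l3 * n0, y); (l1 * n1, fun i => a i ^+ 2);
  (l1 * n2 + l2 * n1, fun i => a i * b i);
  (l2 * n2 + (l1 * n3 + l3 * n1), fun i => b i ^+ 2);
  (l2 * n3 + l3 * n2, fun i => b i * y i); (l3 * n3, fun i => y i ^+ 2)]) => // i.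
by rewrite /evi /ev /=; have q := on_q i; rewrite /quadric in q; ring: q.
Qed.

End Weights.
End Moments.
End Quadric.

(** * Independence of points of the surface *)

Section Independence.
Variables (F : fieldType) (c k0 k1 k2 : F).
Hypothesis n_rootless : forall z : F, z ^+ 2 + z + c != 0.
Hypothesis k_rootless : forall z : F, z ^+ 3 + k2 * z ^+ 2 + k1 * z + k0 != 0.

Definition f0 (a b y : F) := b * y + k2 * b ^+ 2 + k1 * (a * b) + k0 * a ^+ 2.
Definition f1 (a b y : F) := y ^+ 2 + k2 * (b * y) + k1 * b ^+ 2 + k0 * (a * b).

Variables (I : finType) (a b y : I -> F).
Hypothesis on_q : forall i, quadric c (a i) (b i) (y i).
Hypothesis pt_inj : injective (fun i => (a i, b i)).

Let f0i i := f0 (a i) (b i) (y i).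
Let f1i i := f1 (a i) (b i) (y i).

Lemma mom_lin3 (p q r : F) (w f g h : I -> F) :
  p * mom w f + q * mom w g + r * mom w h =
  mom w (fun i => p * f i + q * g i + r * h i).
Proof. by rewrite /mom !mulr_sumr -!big_split /=; apply: eq_bigr => i _; ring. Qed.

Lemma mom_lin4 (p q r : F) (w f g h e : I -> F) :
  p * mom w f + q * mom w g + r * mom w h + mom w e =
  mom w (fun i => p * f i + q * g i + r * h i + e i).
Proof. by rewrite /mom !mulr_sumr -!big_split /=; apply: eq_bigr => i _; ring. Qed.

Lemma coplanar_free (w : I -> F) l : (#|I| <= 5)%N ->
    l != (0, 0, 0, 0) -> (forall i, evi a b y l i = 0) ->
    affine_mom0 a b y w -> mom w f0i = 0 -> mom w f1i = 0 ->
  forall i, w i = 0.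
Proof.
case: l => [[[l0 l1] l2] l3] cI lN0 plane aff mf0 mf1 i0.
have [m1 ma mb my] := aff.
have gN0 : [|| l1 != 0, l2 != 0 | l3 != 0].
  apply: contraR lN0; rewrite !negb_or !negbK => /and3P[/eqP e1 /eqP e2 /eqP e3].
  by have := plane i0; rewrite e1 e2 e3 /evi /ev /= !mul0r !addr0 => ->.
have plane' i : l0 + l1 * a i + l2 * b i + l3 * y i = 0 := plane i.
have quad : quad_mom0 a b y w.
  apply: (@apolar_eq0 _ k0 k1 k2 l1 l2 l3) => //; rewrite ?mom_lin4 ?mom_lin3.
  - by rewrite -mf0; apply: eq_bigr => i _; rewrite /f0i /f0; ring.
  - by rewrite -mf1; apply: eq_bigr => i _; rewrite /f1i /f1; ring.
  (* The plane equation times [a], [b], [y] in turn, with [a y] eliminated, has leading part psi, z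
     psi, z^2 psi and an affine remainder. *)
  - apply: (@mom_comb _ _ _ [:: (- l0, a); (- l3, b); (- l3 * c, fun=> 1)]) => //= i.
    have q := on_q i; rewrite /quadric in q.
    transitivity (a i * (l0 + l1 * a i + l2 * b i + l3 * y i)
      - l0 * a i - l3 * (b i + c)); first by ring: q.
    by rewrite plane'; ring.
  - apply: (@mom_comb _ _ _ [:: (- l0, b)]) => //= i.
    transitivity (b i * (l0 + l1 * a i + l2 * b i + l3 * y i) - l0 * b i); first by ring.
    by rewrite plane'; ring.
  - apply: (@mom_comb _ _ _ [:: (- l0, y); (- l1, b); (- l1 * c, fun=> 1)]) => //= i.
    have q := on_q i; rewrite /quadric in q.
    transitivity (y i * (l0 + l1 * a i + l2 * b i + l3 * y i)
      - l0 * y i - l1 * (b i + c)); first by ring: q.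
    by rewrite plane'; ring.
apply: (weights_eq0 n_rootless on_q pt_inj (d := 2)) => // -[|l [|m []]] // _.
have := quad_killed on_q aff quad l m; rewrite /mom => killed.
by under eq_bigr do rewrite !big_cons big_nil mulr1; apply: killed.
Qed.

Lemma mom_weight (w g f : I -> F) : mom (fun i => w i * g i) f = mom w (fun i => g i * f i).
Proof. by apply: eq_bigr => i _; rewrite mulrA. Qed.

(** The affine relations between the points thus form a space of dimension at most one, whereas six
    points in a solid have at least two independent relations. The function [e] is the relation z^2
    g that must be imposed by hand. *)
Lemma quadric_section_free L0 L1 : (#|I| <= 7)%N ->
    (forall l, (forall i, evi a b y l i = 0) -> l = (0, 0, 0, 0)) ->
    (forall i, f0i i = evi a b y L0 i) -> (forall i, f1i i = evi a b y L1 i) ->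
  exists e : I -> F, forall w : I -> F,
    affine_mom0 a b y w -> mom w e = 0 -> forall i, w i = 0.
Proof.
case: L0 L1 => [[[p0 p1] p2] p3] [[[n0 n1] n2] n3] cI nonplane.
rewrite /f0i /f0 /f1i /f1 /evi /ev /= => f0E f1E.
(* On the quadric b f0 - a f1 = -(b + c)(y + k2 b). After substituting [L0] and [L1], the z^3
   coefficient of the resulting quadratic relation is [d]; subtracting d f0 leaves the leading part
   g. *)
pose d := p3 + 1.
pose g0 := - n1 - d * k0; pose g1 := p1 - n2 - d * k1.
pose g2 := p2 - n3 + k2 - d * k2.
(* On the quadric [b f0 - a f1] and [y f0 - b f1] are quadratic in (a, b, y);
   comparing with [f0 = L0], [f1 = L1] gives two more quadratic relations. *)
pose r1 i := g0 * a i ^+ 2 + g1 * (a i * b i) + g2 * b i ^+ 2.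
pose r2 i := g0 * (a i * b i) + g1 * b i ^+ 2 + g2 * (b i * y i).
pose e i := g0 * b i ^+ 2 + g1 * (b i * y i) + g2 * y i ^+ 2.
have r1E i : r1 i = - ((d * p0 - n3 * c) + (d * p1 - n0) * a i
    + (p0 - n3 + c * k2 + d * p2) * b i + (c + d * p3) * y i).
  have q := on_q i; rewrite /quadric in q.
  transitivity ((p0 + p1 * a i + p2 * b i + p3 * y i) * (b i + d)
    - (n0 + n1 * a i + n2 * b i + n3 * y i) * a i
    + (b i + c) * (y i + k2 * b i)
    - d * (b i * y i + k2 * b i ^+ 2 + k1 * (a i * b i) + k0 * a i ^+ 2)
    - ((d * p0 - n3 * c) + (d * p1 - n0) * a i
    + (p0 - n3 + c * k2 + d * p2) * b i + (c + d * p3) * y i)).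
    by rewrite /r1 /g0 /g1 /g2 /d; ring: q.
  by rewrite -f0E -f1E; ring: q.
(* If g = 0, the affine right side of [r1E] vanishes at all points, hence identically; its
   y-coefficient c + d (d - 1) then makes -d a root of z^2 + z + c. *)
have gN0 : [|| g0 != 0, g1 != 0 | g2 != 0].
  case: (boolP [|| _, _ | _]) => //; rewrite !negb_or !negbK => /and3P[/eqP z0 /eqP z1 /eqP z2].
  have /(congr1 snd) /= cd : (d * p0 - n3 * c, d * p1 - n0,
      p0 - n3 + c * k2 + d * p2, c + d * p3) = (0, 0, 0, 0).
    apply: nonplane => i; rewrite /evi /ev /=.
    by apply: oppr_inj; rewrite -r1E /r1 z0 z1 z2; ring.
  by case/eqP: (n_rootless (- d)); rewrite -[RHS]cd /d; ring.
exists e => w aff me0.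
have [m1 ma mb my] := aff.
have mf0 : mom w f0i = 0.
  apply: (@mom_comb _ _ _ [:: (p0, fun=> 1); (p1, a); (p2, b); (p3, y)]) => //= i.
  by rewrite /f0i /f0 f0E; ring.
have mf1 : mom w f1i = 0.
  apply: (@mom_comb _ _ _ [:: (n0, fun=> 1); (n1, a); (n2, b); (n3, y)]) => //= i.
  by rewrite /f1i /f1 f1E; ring.
have quad : quad_mom0 a b y w.
  apply: (@apolar_eq0 _ k0 k1 k2 g0 g1 g2) => //; rewrite ?mom_lin4 ?mom_lin3.
  - by rewrite -mf0; apply: eq_bigr => i _; rewrite /f0i /f0; ring.
  - by rewrite -mf1; apply: eq_bigr => i _; rewrite /f1i /f1; ring.
  - apply: (@mom_comb _ _ _ [:: (- (d * p0 - n3 * c), fun=> 1); (- (d * p1 - n0), a);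
      (- (p0 - n3 + c * k2 + d * p2), b); (- (c + d * p3), y)]) => //= i.
    by rewrite -/(r1 i) r1E; ring.
  (* Here the z^4 coefficient of y L0 - b L1 is p3 = d - 1, so subtracting (d - 1) f1 leaves z g. *)
  - apply: (@mom_comb _ _ _ [:: (1 - d, f1i); (- p1 * c, fun=> 1); (k0 * c, a);
      (c * k1 + n0 - p1, b); (- p0, y)]) => //= i.
    have q := on_q i; rewrite /quadric in q.
    transitivity (r2 i
      + y i * (b i * y i + k2 * b i ^+ 2 + k1 * (a i * b i) + k0 * a i ^+ 2)
      - y i * (p0 + p1 * a i + p2 * b i + p3 * y i)
      - b i * (y i ^+ 2 + k2 * (b i * y i) + k1 * b i ^+ 2 + k0 * (a i * b i))
      + b i * (n0 + n1 * a i + n2 * b i + n3 * y i)).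
      by rewrite f0E f1E /r2; ring.
    by rewrite /r2 /f1i /f1 /g0 /g1 /g2 /d; ring: q.
  - exact: me0.
have [maa mab mbb mby myy] := quad.
have may : mom w (fun i => a i * y i) = 0.
  apply: (@mom_comb _ _ _ [:: (1, fun i => b i ^+ 2); (1, b); (c, fun=> 1)]) => //= i.
  by rewrite on_q; ring.
(* Apolarity once more: these cubic monomials are 1, z, ..., z^4 on the conic, and a f0, b f0, a r1,
   b r1, y r1 supply kappa, z kappa, g, z g, z^2 g. *)
have cubic : [/\ mom w (fun i => a i ^+ 3) = 0, mom w (fun i => a i ^+ 2 * b i) = 0,
    mom w (fun i => a i * b i ^+ 2) = 0, mom w (fun i => b i ^+ 3) = 0
  & mom w (fun i => b i ^+ 2 * y i) = 0].
  have mL (g : I -> F) : mom w g = 0 -> mom w (fun i => g i * a i) = 0 ->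
      mom w (fun i => g i * b i) = 0 -> mom w (fun i => g i * y i) = 0 ->
    mom w (fun i => g i * r1 i) = 0 /\ mom w (fun i => g i * f0i i) = 0.
    move=> mg mga mgb mgy; split.
      apply: (@mom_comb _ _ _ [:: (- (d * p0 - n3 * c), g);
        (- (d * p1 - n0), fun i => g i * a i);
        (- (p0 - n3 + c * k2 + d * p2), fun i => g i * b i);
        (- (c + d * p3), fun i => g i * y i)]) => //= i.
      by rewrite r1E; ring.
    apply: (@mom_comb _ _ _ [:: (p0, g); (p1, fun i => g i * a i);
      (p2, fun i => g i * b i); (p3, fun i => g i * y i)]) => //= i.
    by rewrite /f0i /f0 f0E; ring.
  have mC (f g : I -> F) : (forall i, f i = g i) -> mom w g = 0 -> mom w f = 0.
    by move=> fg <-; apply: eq_bigr => i _; rewrite fg.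
  have [ar1 af0] : mom w (fun i => a i * r1 i) = 0 /\ mom w (fun i => a i * f0i i) = 0.
    by apply: mL.
  have [br1 bf0] : mom w (fun i => b i * r1 i) = 0 /\ mom w (fun i => b i * f0i i) = 0.
    by apply: mL => //; apply: (mC _ _ _ mab) => i; ring.
  have [yr1 yf0] : mom w (fun i => y i * r1 i) = 0 /\ mom w (fun i => y i * f0i i) = 0.
    apply: mL => //; [apply: (mC _ _ _ may)|apply: (mC _ _ _ mby)] => i; ring.
  apply: (@apolar_eq0 _ k0 k1 k2 g0 g1 g2) => //; rewrite ?mom_lin4 ?mom_lin3.
  - apply: (@mom_comb _ _ _ [:: (1, fun i => a i * f0i i); (-1, fun i => b i ^+ 2);
      (- c, b)]) => //= i.
    by have q := on_q i; rewrite /quadric in q; rewrite /f0i /f0; ring: q.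
  - by apply: (mC _ _ _ bf0) => i; rewrite /f0i /f0; ring.
  - by apply: (mC _ _ _ ar1) => i; rewrite /r1; ring.
  - by apply: (mC _ _ _ br1) => i; rewrite /r1; ring.
  - apply: (@mom_comb _ _ _ [:: (1, fun i => y i * r1 i);
      (- g0, fun i => a i * b i); (- g0 * c, a); (- g1, fun i => b i ^+ 2);
      (- g1 * c, b)]) => //= i.
    by have q := on_q i; rewrite /quadric in q; rewrite /r1; ring: q.
have [maaa maab mabb mbbb mbby] := cubic.
(* The remaining powers z^5 and z^6 come from y f0 and y f1, with leading parts z^2 kappa and z^3
   kappa. *)
have mbyy : mom w (fun i => b i * y i ^+ 2) = 0.
  apply: (@mom_comb _ _ _ [:: (p0, y); (p1, fun i => a i * y i);
    (p2, fun i => b i * y i); (p3, fun i => y i ^+ 2); (- k2, fun i => b i ^+ 2 * y i);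
    (- k1, fun i => b i ^+ 3); (- k1, fun i => b i ^+ 2); (- k1 * c, b);
    (- k0, fun i => a i * b i ^+ 2); (- k0, fun i => a i * b i);
    (- k0 * c, a)]) => //= i.
  have q := on_q i; rewrite /quadric in q.
  transitivity (y i * (b i * y i + k2 * b i ^+ 2 + k1 * (a i * b i) + k0 * a i ^+ 2)
    - y i * (k2 * b i ^+ 2 + k1 * (a i * b i) + k0 * a i ^+ 2)); first by ring.
  by rewrite f0E; ring: q.
have myyy : mom w (fun i => y i ^+ 3) = 0.
  apply: (@mom_comb _ _ _ [:: (n0, y); (n1, fun i => a i * y i);
    (n2, fun i => b i * y i); (n3, fun i => y i ^+ 2); (- k2, fun i => b i * y i ^+ 2);
    (- k1, fun i => b i ^+ 2 * y i); (- k0, fun i => b i ^+ 3);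
    (- k0, fun i => b i ^+ 2); (- k0 * c, b)]) => //= i.
  have q := on_q i; rewrite /quadric in q.
  transitivity (y i * (y i ^+ 2 + k2 * (b i * y i) + k1 * b i ^+ 2 + k0 * (a i * b i))
    - y i * (k2 * (b i * y i) + k1 * b i ^+ 2 + k0 * (a i * b i))); first by ring.
  by rewrite f1E; ring: q.
have maby : mom w (fun i => a i * b i * y i) = 0.
  apply: (@mom_comb _ _ _ [:: (1, fun i => b i ^+ 3); (1, fun i => b i ^+ 2);
    (c, b)]) => //= i.
  by have q := on_q i; rewrite /quadric in q; ring: q.
have mayy : mom w (fun i => a i * y i ^+ 2) = 0.
  apply: (@mom_comb _ _ _ [:: (1, fun i => b i ^+ 2 * y i); (1, fun i => b i * y i);
    (c, y)]) => //= i.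
  by have q := on_q i; rewrite /quadric in q; ring: q.
have maay : mom w (fun i => a i ^+ 2 * y i) = 0.
  apply: (@mom_comb _ _ _ [:: (1, fun i => a i * b i ^+ 2); (1, fun i => a i * b i);
    (c, a)]) => //= i.
  by have q := on_q i; rewrite /quadric in q; ring: q.
have mE (f g : I -> F) : mom w g = 0 -> (forall i, f i = g i) -> mom w f = 0.
  by move=> <- fg; apply: eq_bigr => i _; rewrite fg.
apply: (weights_eq0 n_rootless on_q pt_inj (d := 3)) => // -[|l [|m [|n []]]] // _.
pose mn i := evi a b y m i * evi a b y n i.
apply: (@mom_comb _ _ _ [:: (l.1.1.1, mn); (l.1.1.2, fun i => a i * mn i);
   (l.1.2, fun i => b i * mn i); (l.2, fun i => y i * mn i)]) => /= [i|].
  by rewrite !big_cons big_nil /mn {1}/evi /ev; ring.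
split; first exact: quad_killed.
(* Absorbing a coordinate of the first plane into the weights turns cubic moments into quadratic
   ones, so [quad_killed] applies to the other two planes. *)
do 3?split=> //; rewrite -mom_weight; apply: (quad_killed on_q); split; rewrite mom_weight;
  match goal with
  | |- mom _ ?f = 0 => first
    [ apply: (mE f _ ma) => i; ring | apply: (mE f _ mb) => i; ring
    | apply: (mE f _ my) => i; ring | apply: (mE f _ maa) => i; ring
    | apply: (mE f _ mab) => i; ring | apply: (mE f _ mbb) => i; ring
    | apply: (mE f _ may) => i; ring | apply: (mE f _ mby) => i; ring
    | apply: (mE f _ myy) => i; ring | apply: (mE f _ maaa) => i; ring
    | apply: (mE f _ maab) => i; ring | apply: (mE f _ mabb) => i; ring
    | apply: (mE f _ maay) => i; ring | apply: (mE f _ maby) => i; ring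
    | apply: (mE f _ mayy) => i; ring | apply: (mE f _ mbbb) => i; ring
    | apply: (mE f _ mbby) => i; ring | apply: (mE f _ mbyy) => i; ring
    | apply: (mE f _ myyy) => i; ring ]
  end.
Qed.

End Independence.

(** * The surface in AG(5,q) *)

Section Surface.
Variables (F : finFieldType) (c k0 k1 k2 : F).

Definition height (p : F * F) : F := (p.2 ^+ 2 + p.2 + c) / p.1.

Definition coords (p : F * F) : seq F :=
  let: (a, b) := p in let y := height p in
  [:: a; b; y; f0 k0 k1 k2 a b y; f1 k0 k1 k2 a b y].

Definition spt (p : F * F) : 'rV[F]_5 := \row_j (coords p)`_j.

Definition surface : {set 'rV[F]_5} := spt @: [set p | p.1 != 0].

Lemma hom_spt p j : Defs.hom (spt p) 0 j = (1 :: coords p)`_j.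
Proof.
rewrite /Defs.hom mxE; case: (splitP j) => [j0 ->|j1 ->]; rewrite ?mxE //.
by rewrite ord1.
Qed.

Lemma spt_inj : injective spt.
Proof.
move=> [a b] [a' b'] /rowP e.
by have := e 0; have := e 1; rewrite !mxE /= => -> ->.
Qed.

Lemma mem_surface p : (spt p \in surface) = (p.1 != 0).
Proof. by rewrite mem_imset ?inE //; apply: spt_inj. Qed.

Lemma card_surface : #|surface| = (#|F| ^ 2 - #|F|)%N.
Proof.
rewrite card_imset; last exact: spt_inj.
rewrite (_ : [set p | _] = setX [set~ 0] setT); last first.
  by apply/setP => -[a b]; rewrite !inE andbT.
by rewrite cardsX cardsC1 cardsT -subn1 mulnBl mul1n.
Qed.

Lemma surface_points k (U : 'M[F]_6) : (k <= npts_on surface U)%N ->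
  exists p : 'I_k -> F * F, [/\ injective p, forall i, (p i).1 != 0
    & forall i, (Defs.hom (spt (p i)) <= U)%MS].
Proof.
rewrite /npts_on; set S := [set x in _ | _] => le_k.
pose e (i : 'I_k) := enum_val (widen_ord le_k i).
have eP i : exists p, (p.1 != 0) && (e i == spt p).
  have := enum_valP (widen_ord le_k i); rewrite inE => /andP[/imsetP[p]].
  by rewrite inE => p0 ep _; exists p; rewrite p0; apply/eqP.
exists (fun i => xchoose (eP i)); split=> [i j eij|i|i].
- have /andP[_ /eqP ei] := xchooseP (eP i); have /andP[_ /eqP ej] := xchooseP (eP j).
  have /enum_val_inj/(congr1 val) : e i = e j by rewrite ei ej eij.
  by move=> /= ?; apply: val_inj.
- by have /andP[] := xchooseP (eP i).
- have /andP[_ /eqP <-] := xchooseP (eP i).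
  by have := enum_valP (widen_ord le_k i); rewrite inE => /andP[].
Qed.

Hypothesis n_rootless : forall z : F, z ^+ 2 + z + c != 0.
Hypothesis k_rootless : forall z : F, z ^+ 3 + k2 * z ^+ 2 + k1 * z + k0 != 0.

(** * Ranks of finite families of points of the surface *)

Section Points.
Variables (k : nat) (p : 'I_k -> F * F).
Hypothesis p_neq0 : forall i, (p i).1 != 0.
Hypothesis p_inj : injective p.

Let a i := (p i).1.
Let b i := (p i).2.
Let y i := height (p i).

Lemma on_quadric i : quadric c (a i) (b i) (y i).
Proof. by rewrite /quadric /y /height mulrC divfK. Qed.

Lemma pair_inj : injective (fun i => (a i, b i)).
Proof.
move=> i j /= [ea eb]; apply: p_inj.
by rewrite (surjective_pairing (p i)) [p j]surjective_pairing -/(a i) -/(b i) ea eb.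
Qed.

Definition pmx : 'M[F]_(k, 6) := \matrix_(i, j) (1 :: coords (p i))`_j.
(** The first four columns of [pmx]: the projection of the points to AG(3,q). *)
Definition affmx : 'M[F]_(k, 4) := \matrix_(i, j) (1 :: coords (p i))`_j.

Lemma row_pmx i : row i pmx = Defs.hom (spt (p i)).
Proof. by apply/rowP => j; rewrite hom_spt !mxE. Qed.

Lemma pmx_sub (U : 'M[F]_6) :
  (forall i, (Defs.hom (spt (p i)) <= U)%MS) -> (pmx <= U)%MS.
Proof. by move=> pU; apply/row_subP => i; rewrite row_pmx. Qed.

Lemma kermx_mom (w : 'rV[F]_k) : w *m pmx = 0 ->
  [/\ affine_mom0 a b y (w 0),
     mom (w 0) (fun i => f0 k0 k1 k2 (a i) (b i) (y i)) = 0
   & mom (w 0) (fun i => f1 k0 k1 k2 (a i) (b i) (y i)) = 0].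
Proof.
move=> /rowP wM.
have wj (j : 'I_6) : mom (w 0) (fun i => (1 :: coords (p i))`_j) = 0.
  by have := wM j; rewrite !mxE => e0; rewrite -[RHS]e0; apply: eq_bigr => i _; rewrite !mxE.
have coE i : coords (p i) = [:: a i; b i; y i; f0 k0 k1 k2 (a i) (b i) (y i);
    f1 k0 k1 k2 (a i) (b i) (y i)] by rewrite /a /b /y; case: (p i).
have {}wj (j : 'I_6) : mom (w 0) (fun i => [:: 1; a i; b i; y i; f0 k0 k1 k2 (a i) (b i) (y i);
    f1 k0 k1 k2 (a i) (b i) (y i)]`_j) = 0.
  by rewrite -[RHS](wj j); apply: eq_bigr => i _; rewrite coE.
by split; [split|..]; [apply: (wj 0)|apply: (wj 1)|apply: (wj 2%:R)|apply: (wj 3%:R)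
  |apply: (wj 4%:R)|apply: (wj 5%:R)].
Qed.

Lemma affmx_coplanar : (\rank affmx < 4)%N ->
  exists2 l, l != (0, 0, 0, 0) & forall i, evi a b y l i = 0.
Proof.
move=> rk; have : kermx affmx^T != 0 by rewrite kermx_eq0 /row_free mxrank_tr neq_ltn rk.
case/rowV0Pn => v /sub_kermxP vA vN0.
exists (v 0 0, v 0 1, v 0 2%:R, v 0 3%:R).
  apply: contra vN0 => /eqP [v0 v1 v2 v3]; apply/eqP/rowP => j; rewrite mxE.
  case: j => -[|[|[|[|//]]]] lt4; [rewrite -[RHS]v0|rewrite -[RHS]v1|rewrite -[RHS]v2|
    rewrite -[RHS]v3]; congr (v 0 _); exact: val_inj.
move=> i; have /rowP/(_ i) := vA; rewrite !mxE !big_ord_recl big_ord0 !mxE => e0; rewrite -[RHS]e0.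
rewrite /evi /ev /a /b /y /=; case: (p i) => pa pb /=; rewrite mulr1 addr0 !addrA.
by congr (_ + v 0 _ * _ + v 0 _ * _ + v 0 _ * _); apply: val_inj.
Qed.

(** The rank conditions make the column spaces of [pmx] and [affmx] equal, so f0 and f1 become
    affine on the points; full column rank of [affmx] excludes a common plane. *)
Lemma affmx_span : (\rank pmx <= 4)%N -> \rank affmx = 4%N ->
  (forall j : 'I_6, exists l, forall i, (1 :: coords (p i))`_j = evi a b y l i)
  /\ (forall l, (forall i, evi a b y l i = 0) -> l = (0, 0, 0, 0)).
Proof.
move=> rkM rkA; split=> [j|].
  have sAM : (affmx^T <= pmx^T)%MS.
    apply/row_subP => t; rewrite (_ : row t _ = row (widen_ord (isT : 4 <= 6)%N t) pmx^T).
      exact: row_sub.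
    by apply/rowP => i; rewrite !mxE.
  have sMA : (pmx^T <= affmx^T)%MS.
    have [_] := mxrank_leqif_sup sAM; rewrite !mxrank_tr rkA => <-.
    by rewrite eqn_leq -{1}rkA -[\rank affmx]mxrank_tr -[\rank pmx]mxrank_tr (mxrankS sAM) mxrank_tr.
  have /submxP[D De] := submx_trans (row_sub j pmx^T) sMA.
  exists (D 0 0, D 0 1, D 0 2%:R, D 0 3%:R) => i.
  have /rowP/(_ i) := De; rewrite !mxE !big_ord_recl big_ord0 !mxE => ->.
  rewrite /evi /ev /a /b /y /=; case: (p i) => pa pb /=; rewrite mulr1 addr0 !addrA.
  by congr (_ + D 0 _ * _ + D 0 _ * _ + D 0 _ * _); apply: val_inj.
move=> [[[l0 l1] l2] l3] le.
pose v : 'rV[F]_4 := \row_j [:: l0; l1; l2; l3]`_j.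
have vA : v *m affmx^T = 0.
  apply/rowP => i; rewrite !mxE !big_ord_recl big_ord0 !mxE -[RHS](le i).
  rewrite /evi /ev /a /b /y /=; case: (p i) => pa pb /=; rewrite mulr1 addr0 !addrA.
  by [].
have v0 : v = 0.
  apply/eqP; rewrite -submx0; move/sub_kermxP: vA.
  by rewrite (_ : kermx _ = 0) //; apply/eqP; rewrite kermx_eq0 /row_free mxrank_tr rkA.
have vj (j : 'I_4) : [:: l0; l1; l2; l3]`_j = 0 by have /rowP/(_ j) := v0; rewrite !mxE.
by have := (vj 0, vj 1, vj 2%:R, vj 3%:R) => /= -[[[-> ->] ->] ->].
Qed.

Lemma coplanar_pmx_free l : (k <= 5)%N -> l != (0, 0, 0, 0) ->
  (forall i, evi a b y l i = 0) -> row_free pmx.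
Proof.
move=> k5 lN0 le; rewrite -kermx_eq0; apply/rowV0P => w /sub_kermxP /kermx_mom[aff m0 m1].
apply/rowP => i; rewrite mxE.
by apply: (coplanar_free n_rootless k_rootless on_quadric pair_inj _ lN0 le aff m0 m1); rewrite card_ord.
Qed.

(** Either the projections to AG(3,q) are coplanar and the planar case applies, or they are already
    independent. *)
Lemma four_points_free : (k <= 4)%N -> row_free pmx.
Proof.
move=> k4; case: (ltnP (\rank affmx) 4) => [/affmx_coplanar[l lN0 le]|rk].
  by apply: (coplanar_pmx_free (leqW k4) lN0 le).
rewrite -kermx_eq0; apply/rowV0P => w /sub_kermxP wM.
have wA : w *m affmx = 0.
  apply/rowP => j; have /rowP/(_ (widen_ord (isT : 4 <= 6)%N j)) := wM; rewrite !mxE => e0; rewrite -[RHS]e0.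
  by apply: eq_bigr => i _; rewrite !mxE.
apply/eqP; rewrite -submx0; move/sub_kermxP: wA; rewrite (_ : kermx _ = 0) //; apply/eqP.
by rewrite kermx_eq0 /row_free eqn_leq rank_leq_row (leq_trans k4 rk).
Qed.

Lemma six_points_rank : (k <= 7)%N -> (6 <= k)%N -> \rank affmx = 4%N -> (4 < \rank pmx)%N.
Proof.
move=> k7 k6 rkA; rewrite ltnNge; apply/negP => rkM.
have [span nonplane] := affmx_span rkM rkA.
have [l0 l0E] := span 4%:R; have [l1 l1E] := span 5%:R.
have [e eP] : exists e : 'I_k -> F, forall w : 'I_k -> F,
    affine_mom0 a b y w -> mom w e = 0 -> forall i, w i = 0.
  apply: (quadric_section_free n_rootless k_rootless on_quadric pair_inj _ nonplane (L0 := l0) (L1 := l1)) => [|i|i].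
  - by rewrite card_ord.
  - by rewrite -l0E /a /b /y; case: (p i).
  - by rewrite -l1E /a /b /y; case: (p i).
(* Rank at most 4 leaves a nonzero relation even after the extra column [e] is appended. *)
have : kermx (row_mx pmx (\col_i e i)) != 0.
  rewrite kermx_eq0 /row_free neq_ltn; apply/orP; left.
  apply: leq_trans k6; rewrite ltnS -mxrank_tr tr_row_mx -addsmxE.
  by apply: (leq_trans (mxrank_adds_leqif _ _)); rewrite mxrank_tr (leq_add rkM) // rank_leq_row.
case/rowV0Pn => w /sub_kermxP; rewrite mul_mx_row => /eqP; rewrite row_mx_eq0 => /andP[/eqP wM /eqP we].
case/eqP; apply/rowP => i; rewrite mxE; apply: eP; first by case: (kermx_mom wM).
by have /rowP/(_ 0) := we; rewrite !mxE => e0; rewrite -[RHS]e0; apply: eq_bigr => j _; rewrite !mxE.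
Qed.

End Points.

Lemma surface_plane (U : 'M[F]_6) : (\rank U <= 3)%N -> (npts_on surface U <= 3)%N.
Proof.
move=> rU; rewrite leqNgt; apply/negP => /surface_points[p [pi p0 pU]].
have := four_points_free p0 pi isT; rewrite /row_free => /eqP rk.
by have := leq_trans (mxrankS (pmx_sub pU)) rU; rewrite rk.
Qed.

Lemma surface_solid (U : 'M[F]_6) : (\rank U <= 4)%N -> (npts_on surface U <= 5)%N.
Proof.
move=> rU; rewrite leqNgt; apply/negP => /surface_points[p [pi p0 pU]].
have rkM := leq_trans (mxrankS (pmx_sub pU)) rU.
have [/affmx_coplanar[l lN0 le]|rkA] := ltnP (\rank (affmx p)) 4; last first.
  have rkA4 : \rank (affmx p) = 4%N by apply/eqP; rewrite eqn_leq rank_leq_col.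
  by have := six_points_rank p0 pi isT isT rkA4; rewrite ltnNge rkM.
(* If the six projections are coplanar, five of the points are already independent, too many for
   rank 4. *)
pose p' (i : 'I_5) := p (widen_ord (isT : 5 <= 6)%N i).
have pi' : injective p' by move=> i j /pi/(congr1 val)/= ?; apply: val_inj.
have := @coplanar_pmx_free 5 p' (fun i => p0 _) pi' l isT lN0 (fun i => le _).
rewrite /row_free => /eqP rk.
by have := leq_trans (mxrankS (@pmx_sub 5 p' U (fun i => pU _))) rU; rewrite rk.
Qed.

End Surface.

(** * Choice of the coefficients *)

Lemma ex_notin (T : finType) (s : seq T) : (size s < #|T|)%N -> exists x, x \notin s.
Proof.
move=> lt_s; apply/existsP; apply: contraTT lt_s; rewrite negb_exists -leqNgt => /forallP all_s.
rewrite cardE; apply: uniq_leq_size (enum_uniq _) _ => x _.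
by have := all_s x; rewrite negbK.
Qed.

Lemma ex_not_value (T : finType) (f : T -> T) x y :
  x != y -> f x = f y -> exists v, forall z, f z != v.
Proof.
move=> xy fxy; have : (#|image f T| < #|T|)%N.
  rewrite ltn_neqAle leq_image_card andbT; apply: contra xy => /image_injP inj_f.
  by apply/eqP/inj_f.
move=> lt; have /existsP[v vP] : [exists v, v \notin image f T].
  apply: contraTT lt; rewrite negb_exists -leqNgt => /forallP all_v.
  by apply/subset_leq_card/subsetP => z _; have := all_v z; rewrite negbK.
by exists v => z; apply: contra vP => /eqP <-; rewrite image_f.
Qed.

Section Field.
Variable F : finFieldType.
Hypothesis card_F : (4 <= #|F|)%N.

Lemma quadratic_eq0 (A B C : F) :
  (forall a, a != 0 -> A * a ^+ 2 + B * a + C = 0) -> [/\ A = 0, B = 0 & C = 0].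
Proof.
move=> h; pose P := Poly [:: C; B; A].
have P0 : P = 0.
  apply: (@roots_geq_poly_eq0 _ P (enum [set~ 0])).
  - apply/allP => a; rewrite mem_enum !inE => a0.
    by rewrite rootE horner_Poly /= -[X in _ == X](h a a0); apply/eqP; ring.
  - exact: enum_uniq.
  - apply: (leq_trans (size_Poly _)).
    by rewrite -cardE cardsC1 /=; case: #|F| card_F.
have cf i : [:: C; B; A]`_i = 0 by rewrite -coef_Poly -/P P0 coef0.
by split; [apply: (cf 2)|apply: (cf 1)|apply: (cf 0)].
Qed.

(* In characteristic 2 the inverse of 2 is the junk value 0. *)
Lemma double_succ_neq0 (v : F) : v != - 2%:R^-1 -> v *+ 2 + 1 != 0.
Proof.
apply: contra => /eqP e; have e' : v *+ 2 = -1 by apply/eqP; rewrite -subr_eq0 opprK e.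
have two : 2%:R != 0 :> F.
  by apply: contra_eq_neq e' => t; rewrite -mulr_natr t mulr0 eq_sym oppr_eq0 oner_eq0.
by apply/eqP/(mulIf two); rewrite mulNr mulVf // mulr_natr.
Qed.

(** The map [f] is -(z^2 + z) with its value at -1, which it also takes at 0, replaced by 1. It
    still identifies [v] and -1 - v, so it misses some [c], and c != 1 because 1 is attained. *)
Lemma ex_quadratic_rootless : exists2 c : F, c != 1 & forall z, z ^+ 2 + z + c != 0.
Proof.
have [|v] := @ex_notin F [:: 0; -1; - 2%:R^-1]; first exact: card_F.
rewrite !inE !negb_or => /and3P[v0 v1 /double_succ_neq0 v2].
pose f z := if z == -1 then 1 else - (z ^+ 2 + z) : F.
have vw : v != -1 - v.
  by apply: contra v2 => /eqP e; rewrite mulr2n {2}e; apply/eqP; ring.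
have [|c cP] := @ex_not_value F f v (-1 - v) vw.
  rewrite /f (negPf v1) (_ : (-1 - v == -1) = false); first by ring.
  by rewrite -subr_eq0 addrAC subrr sub0r oppr_eq0 (negPf v0).
exists c => [|z]; first by have := cP (-1); rewrite /f eqxx eq_sym.
have [->|zN1] := eqVneq z (-1).
  have := cP 0; rewrite /f [0 == -1]eq_sym oppr_eq0 oner_eq0.
  apply: contra => /eqP e; rewrite -subr_eq0 -oppr_eq0 -[X in _ == X]e; apply/eqP; ring.
have := cP z; rewrite /f (negPf zN1); apply: contra => /eqP e.
by rewrite -subr_eq0 -oppr_eq0 -[X in _ == X]e; apply/eqP; ring.
Qed.

(** The product of the three quantities is a polynomial of degree 5 in [u], which settles q > 5.
    Otherwise u = 1 works: c + 1 = c - 1 for q = 4, while for q = 5 the value c = -1 would make 2 a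
    root. *)
Lemma ex_scale (c : F) : c != 1 -> (forall z, z ^+ 2 + z + c != 0) ->
  exists u, [/\ u != 0, c * u ^+ 2 - 1 != 0 & c * u ^+ 2 + 1 != 0].
Proof.
move=> c1 rl.
have cN0 : c != 0 by have := rl 0; rewrite expr0n /= !add0r.
case: (ltnP 5 #|F|) => [lt5|le5].
  pose P := Poly [:: 0; -1; 0; 0; 0; c ^+ 2].
  have PN0 : P != 0.
    apply/eqP => P0; have : P`_5 = 0 by rewrite P0 coef0.
    by rewrite coef_Poly /= => /eqP; rewrite expf_eq0 (negPf cN0) andbF.
  have [u uP] : exists u, ~~ root P u.
    apply/existsP; apply: contraLR lt5; rewrite negb_exists -leqNgt => /forallP rP.
    rewrite cardE -ltnS; apply: leq_trans (size_Poly [:: 0; -1; 0; 0; 0; c ^+ 2]).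
    apply: max_poly_roots PN0 _ (enum_uniq _); apply/allP => x _.
    by have := rP x; rewrite negbK.
  have : u * (c * u ^+ 2 - 1) * (c * u ^+ 2 + 1) != 0.
    by apply: contra uP => /eqP e; rewrite rootE horner_Poly /= -[X in _ == X]e; apply/eqP; ring.
  by rewrite !mulf_eq0 !negb_or => /andP[/andP[? ?] ?]; exists u.
exists 1; rewrite oner_neq0 expr1n mulr1 subr_eq0 c1; split=> //.
have : (#|F| == 4%N) || (#|F| == 5%N) by case: #|F| card_F le5 => [|[|[|[|[|[|]]]]]].
case/orP => /eqP cF.
  have /pcharf0 two : 2 \in [pchar F] by apply: (@card_finPcharP F 2 2).
  by apply: contra c1 => /eqP e; rewrite -subr_eq0 -[X in _ == X]e -[X in _ == X]subr0 -two; apply/eqP; ring.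
have /pcharf0 five : 5 \in [pchar F] by apply: (@card_finPcharP F 5 1).
apply: contra (rl 2%:R) => /eqP e.
have -> : 2%:R ^+ 2 + 2%:R + c = 5%:R + (c + 1) by ring.
by rewrite five e addr0.
Qed.

(* The root condition solved for k reads k = f z; with the convention x / 0 = 0,
   f takes the value 0 both at 0 and at its pole z0, so it misses some k. *)
Lemma ex_cubic_rootless (c w z0 : F) : c != 1 -> w != 0 -> z0 != 0 -> w * c = z0 ^+ 2 ->
  exists k, forall z, z ^+ 3 + (- (k / (w * c))) * z ^+ 2 + (- w) * z + k != 0.
Proof.
move=> c1 wN0 zN0 wc.
pose f z := - (z * (z ^+ 2 - w)) / (1 - z ^+ 2 / (w * c)).
have wcN0 : w * c != 0 by rewrite wc expf_neq0.
have [|k kP] := @ex_not_value F f z0 0 zN0.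
  by rewrite /f -wc divff // subrr invr0 mulr0 mul0r oppr0 mul0r.
exists k => z; apply/eqP => e.
have {}e : z * (z ^+ 2 - w) + k * (1 - z ^+ 2 / (w * c)) = 0 by rewrite -[RHS]e; ring.
have [d0|dN0] := eqVneq (1 - z ^+ 2 / (w * c)) 0; last first.
  case/eqP: (kP z); rewrite /f; apply: (mulIf dN0); rewrite divfK //.
  by apply/eqP; rewrite eq_sym -subr_eq0 opprK addrC e.
have zz : z ^+ 2 = w * c.
  by apply/eqP; rewrite -(can_eq (divfK wcN0)) // -subr_eq0 -oppr_eq0 opprB divff // d0.
move: e; rewrite d0 mulr0 addr0 => /eqP; rewrite mulf_eq0 zz => /orP[/eqP z_0|].
  by move: wcN0; rewrite -zz z_0 expr0n eqxx.
by rewrite (_ : w * c - w = w * (c - 1)); [rewrite mulf_eq0 (negPf wN0) subr_eq0 (negPf c1)|ring].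
Qed.

End Field.

(** * Dependent points and the theorem *)

Section Existence.
Variable F : finFieldType.
Hypothesis card_F : (4 <= #|F|)%N.

Section Given.
Variables c k0 k1 k2 : F.
Hypothesis n_rootless : forall z : F, z ^+ 2 + z + c != 0.
Hypothesis k_rootless : forall z : F, z ^+ 3 + k2 * z ^+ 2 + k1 * z + k0 != 0.
Local Notation X := (surface c k0 k1 k2).
Local Notation spt := (spt c k0 k1 k2).

(* Comparing the points with b = 0 and b = -1, which share the same a and y,
   isolates the part of a hyperplane equation that is odd under b -> -1 - b. *)
Lemma surface_span (U : 'M[F]_6) :
  (forall x, x \in X -> (Defs.hom x <= U)%MS) -> \rank U = 6%N.
Proof.
move=> XU; apply/eqP; rewrite eqn_leq rank_leq_row leqNgt; apply/negP => rk.
have : kermx U^T != 0 by rewrite kermx_eq0 /row_free mxrank_tr neq_ltn rk.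
case/rowV0Pn => v /sub_kermxP vU /eqP; apply.
have cN0 : c != 0 by have := n_rootless 0; rewrite expr0n /= !add0r.
pose v0 := v 0 0; pose v1 := v 0 1; pose v2 := v 0 2%:R.
pose v3 := v 0 3%:R; pose v4 := v 0 4%:R; pose v5 := v 0 5%:R.
have eqn a b : a != 0 -> let y := height c (a, b) in
    v0 + v1 * a + v2 * b + v3 * y + v4 * f0 k0 k1 k2 a b y + v5 * f1 k0 k1 k2 a b y = 0.
  move=> a0 y; have : (Defs.hom (spt (a, b)) <= U)%MS by apply: XU; rewrite mem_surface.
  case/submxP => D De.
  have : v *m (Defs.hom (spt (a, b)))^T = 0 by rewrite De trmx_mul mulmxA vU mul0mx.
  have homE j : (Defs.hom (spt (a, b)))^T j 0 = (1 :: coords c k0 k1 k2 (a, b))`_j.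
    by rewrite mxE hom_spt.
  move=> /matrixP/(_ 0 0); rewrite mxE [X in _ = X]mxE => e0; rewrite -[RHS]e0.
  rewrite !big_ord_recl big_ord0 !homE /= -/y mulr1 addr0 !addrA.
  by congr (_ + v 0 _ * _ + v 0 _ * _ + v 0 _ * _ + v 0 _ * _ + v 0 _ * _); apply: val_inj.
have [e1 e2 e3] : [/\ v4 * k1 + v5 * k0 = 0, v2 - v4 * k2 - v5 * k1 = 0 & (v4 + k2 * v5) * c = 0].
  apply: (quadratic_eq0 card_F) => a a0.
  have := eqn a (-1) a0; have := eqn a 0 a0; rewrite /height /= /f0 /f1 => E0 E1.
  have := congr2 (fun s t => a * (s - t)) E0 E1.
  rewrite [RHS](_ : _ = 0) => [/= E|]; last by rewrite subrr mulr0.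
  by rewrite -[RHS]E; field.
(* Otherwise v4 = -k2 v5 and [e1] gives k0 = k1 k2, making -k2 a root of kappa. *)
have v5_0 : v5 = 0.
  apply/eqP; apply: contraT => v5N0; move/eqP: e3; rewrite mulf_eq0 (negPf cN0) orbF addr_eq0.
  move=> /eqP v4E; case/eqP: (k_rootless (- k2)); apply: (mulIf v5N0).
  by rewrite mul0r -[RHS]e1 v4E; ring.
have v4_0 : v4 = 0.
  by move/eqP: e3; rewrite v5_0 mulr0 addr0 mulf_eq0 (negPf cN0) orbF => /eqP.
have v2_0 : v2 = 0 by rewrite -[RHS]e2 v4_0 v5_0; ring.
have [v1_0 v0_0 v3c] : [/\ v1 = 0, v0 = 0 & v3 * c = 0].
  apply: (quadratic_eq0 card_F) => a a0; have := eqn a 0 a0.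
  rewrite /height /= v2_0 v4_0 v5_0 => /(congr1 (fun s => a * s)).
  by rewrite [RHS]mulr0 => /= E; rewrite -[RHS]E; field.
have v3_0 : v3 = 0 by move/eqP: v3c; rewrite mulf_eq0 (negPf cN0) orbF => /eqP.
apply/rowP => j; rewrite mxE; case: j => -[|[|[|[|[|[|//]]]]]] lt6;
  [rewrite -[RHS]v0_0|rewrite -[RHS]v1_0|rewrite -[RHS]v2_0|rewrite -[RHS]v3_0
  |rewrite -[RHS]v4_0|rewrite -[RHS]v5_0]; congr (v 0 _); exact: val_inj.
Qed.

Lemma npts_on_ge k (p : 'I_k -> F * F) (U : 'M[F]_6) : injective p ->
  (forall i, (p i).1 != 0) -> (forall i, (Defs.hom (spt (p i)) <= U)%MS) ->
  (k <= npts_on X U)%N.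
Proof.
move=> pi p0 pU; rewrite -{1}[k]card_ord -(card_imset predT (inj_comp (@spt_inj _ c k0 k1 k2) pi)).
apply/subset_leq_card/subsetP => _ /imsetP[i _ ->].
by rewrite inE /= mem_surface p0 pU.
Qed.

Lemma hyperplane_seven_points (U : 'M[F]_6) : \rank U = 4%N -> (5 <= npts_on X U)%N ->
  exists H : 'M[F]_6, \rank H = 5%N /\ (7 <= npts_on X H)%N.
Proof.
move=> rU U5.
have [i1 r1P] : exists i, ~~ (row i 1%:M <= U)%MS.
  by apply/row_subPn; rewrite sub1mx /row_full rU.
set r1 := row i1 _ in r1P; pose U1 := (U + r1)%MS.
have rU1 : (\rank U1 <= 5)%N.
  by apply: (leq_trans (mxrank_adds_leqif _ _)); rewrite rU (leq_add (leqnn 4)) // rank_leq_row.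
have [i2 r2P] : exists i, ~~ (row i 1%:M <= U1)%MS.
  by apply/row_subPn; rewrite sub1mx /row_full neq_ltn ltnS rU1.
set r2 := row i2 _ in r2P.
have ltS (A : 'M[F]_6) (r : 'rV[F]_6) : ~~ (r <= A)%MS -> (\rank A < \rank (A + r)%MS)%N.
  move=> rA; rewrite ltn_neqAle mxrankS ?addsmxSl // andbT.
  have [_ ->] := mxrank_leqif_sup (addsmxSl A r).
  by apply: contra rA; apply: submx_trans (addsmxSr _ _).
have full v : (v <= U + col_mx r1 r2)%MS.
  apply: submx_full; rewrite /row_full eqn_leq rank_leq_col /=.
  apply: leq_trans (mxrankS (_ : (U1 + r2 <= _)%MS)).
    by rewrite (leq_trans _ (ltS _ _ r2P)) // ltnS (leq_trans _ (ltS _ _ r1P)) ?rU.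
  have := submx_refl (col_mx r1 r2); rewrite col_mx_sub => /andP[s1 s2].
  have sU := addsmxSr U (col_mx r1 r2).
  by rewrite !addsmx_sub addsmxSl /= (submx_trans s1 sU) (submx_trans s2 sU).
pose B := col_mx U (col_mx r1 r2).
have fullB (v : 'rV[F]_6) : v *m pinvmx B *m B = v.
  by apply: mulmxKpV; rewrite -addsmxE full.
(* The projection to the quotient by [U], in the coordinates given by [r1] and [r2]. *)
pose phi (v : 'rV[F]_6) : 'rV[F]_2 := rsubmx (v *m pinvmx B).
have phiU v v' mu : phi v' = mu *: phi v -> (v' - mu *: v <= U)%MS.
  move=> e; rewrite -(fullB v') -(fullB v) -[v' *m _]hsubmxK -[v *m _]hsubmxK.
  rewrite !mul_row_col -/(phi v) -/(phi v') e scalerDr -scalemxAl opprD addrACA subrr addr0.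
  by rewrite addmx_sub ?submxMl // eqmx_opp scalemx_sub ?submxMl.
have phi0 v : phi v = 0 -> (v <= U)%MS.
  move=> e; have := @phiU 0 v 0; rewrite scaler0 subr0 scale0r; exact.
(* For a point outside [U], its hyperplane in the pencil through [U], as a point of the projective
   line over F with [None] at infinity. *)
pose cl (x : 'rV[F]_5) := let f := phi (Defs.hom x) in
  if f 0 0 == 0 then None else Some (f 0 1 / f 0 0).
pose V := [set x | (Defs.hom x <= U)%MS]; pose S := X :\: V.
have nptsE : npts_on X U = #|X :&: V| by rewrite /npts_on setIdE.
(* Injectivity would give at most q + 1 points in [S], but [U] contains at most five points of X,
   leaving at least q^2 - q - 5 of them. *)
have inj : ~~ dinjectiveb cl (mem S).
  apply/negP => /dinjectiveP/card_in_imset cS.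
  have := max_card (mem (cl @: S)); rewrite cS card_option => leS.
  have := surface_solid n_rootless k_rootless (eq_leq rU); rewrite nptsE => le5.
  have := cardsID V X; rewrite card_surface -/S -mulnn => eS.
  have := leq_mul card_F (leqnn #|F|); move: leS le5 eS card_F.
  by move: #|S| #|X :&: V| #|F| (#|F| * #|F|)%N => s v q qq; lia.
have /dinjectivePn[x xS [x']] := inj.
rewrite !inE => /andP[x'x /andP[x'U x'X]] clxx'.
move: xS; rewrite !inE => /andP[xU xX].
have sxx' : (Defs.hom x' <= U + Defs.hom x)%MS.
  have [mu mu_e] : exists mu, phi (Defs.hom x') = mu *: phi (Defs.hom x).
    move: clxx'; rewrite /cl; set f := phi _; set f' := phi _.
    have row2 (g g' : 'rV[F]_2) : g 0 0 = g' 0 0 -> g 0 1 = g' 0 1 -> g = g'.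
      move=> g0 g1; apply/rowP => -[[|[|//]] lt2].
        by have -> : Ordinal lt2 = 0 by apply: val_inj.
      by have -> : Ordinal lt2 = 1 by apply: val_inj.
    case: (eqVneq (f 0 0) 0) => f0; case: (eqVneq (f' 0 0) 0) => // f'0.
      have f1 : f 0 1 != 0.
        apply: contra xU => /eqP f1; apply: phi0.
        by apply: row2; rewrite -/f ?f0 ?f1 [RHS]mxE.
      by move=> _; exists (f' 0 1 / f 0 1); apply: row2; rewrite [RHS]mxE ?f0 ?f'0 ?mulr0 ?divfK.
    move=> [e]; exists (f' 0 0 / f 0 0); apply: row2; rewrite [RHS]mxE ?divfK //.
    by rewrite mulrAC -mulrA e mulrC divfK.
  rewrite -[Defs.hom x'](subrK (mu *: Defs.hom x)) addmx_sub //.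
    by apply: submx_trans (addsmxSl _ _); apply: phiU.
  by rewrite scalemx_sub // addsmxSr.
exists (U + Defs.hom x)%MS; split.
  have := ltS _ _ xU; rewrite rU => lt4; apply/eqP; rewrite eqn_leq lt4 andbT.
  by apply: (leq_trans (mxrank_adds_leqif _ _)); rewrite rU (leq_add (leqnn 4)) // rank_leq_row.
have : [set x; x'] :|: (X :&: V) \subset [set z in X | (Defs.hom z <= U + Defs.hom x)%MS].
  rewrite !subUset !sub1set !inE xX x'X sxx' addsmxSr /=.
  apply/subsetP => z; rewrite !inE => /andP[-> zU].
  by rewrite (submx_trans zU) ?addsmxSl.
move/subset_leq_card; apply: leq_trans.
rewrite cardsU (_ : _ :&: (X :&: V) = set0).
  by rewrite cards0 subn0 cards2 eq_sym x'x -nptsE (leq_add (leqnn 2)).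
apply/setP => z; rewrite !inE; apply/negbTE; rewrite negb_and.
by case: eqP => [->|_] /=; [|case: eqP => [->|] //=]; rewrite ?(negPf xU) ?(negPf x'U) !andbF.
Qed.

End Given.

(* The coefficients of the cubic are chosen so that the relation [lam] between the
   projections of the five points to AG(3,q) also kills f0 and f1. *)
Lemma five_points_dependent (c k b : F) :
    (forall z : F, z ^+ 2 + z + c != 0) -> b != 0 -> b + 1 != 0 -> b *+ 2 + 1 != 0 ->
    let w := b * (b + 1) in
    (forall z, z ^+ 3 + (- (k / (w * c))) * z ^+ 2 + (- w) * z + k != 0) ->
  exists U : 'M[F]_6, \rank U = 4%N /\ (5 <= npts_on (surface c k (- w) (- (k / (w * c)))) U)%N.
Proof.
move=> n_rl b0 b1 b2 w k_rl.
have cN0 : c != 0 by have := n_rl 0; rewrite expr0n /= !add0r.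
(* Three points with second coordinate 0, and two with first coordinate 1 exchanged by z -> -1 - z,
   hence of equal height. *)
pose ps : 5.-tuple (F * F) := [tuple (1, 0); (- b^-1, 0); ((b + 1)^-1, 0); (1, b); (1, -1 - b)].
pose lam : 'rV[F]_5 := \row_j [:: (b *+ 2 + 1) * (c - 1); - b ^+ 2; (b + 1) ^+ 2;
  - c * (b + 1); - c * b]`_j.
pose p := tnth ps.
have cd j : p j = nth 0 ps j by rewrite /p (tnth_nth 0).
have p0 j : (p j).1 != 0.
  rewrite cd; case: j => -[|[|[|[|[|//]]]]] lt5 /=; rewrite ?oner_neq0 ?oppr_eq0 ?invr_eq0 //.
have p_inj : injective p.
  have h1 : (1 == - b^-1) = false.
    apply: contraNF b1 => /eqP e; apply/eqP.
    by rewrite -[X in b + X]opprK [X in b - X](_ : _ = b); [ring|apply: (mulIf (invr_neq0 b0)); rewrite divff // mulN1r -e].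
  have h2 : (1 == (b + 1)^-1) = false.
    by rewrite -[1]invr1 (inj_eq invr_inj) invr1 eq_sym -subr_eq0 addrK (negPf b0).
  have h3 : (- b^-1 == (b + 1)^-1) = false.
    rewrite -invrN (inj_eq invr_inj); apply: contraNF b2 => /eqP e.
    by rewrite mulr2n -addrA -e subrr.
  have h4 : (0 == b) = false by rewrite eq_sym (negPf b0).
  have h5 : (0 == -1 - b) = false.
    by rewrite -opprD eq_sym oppr_eq0 addrC (negPf b1).
  have h6 : (b == -1 - b) = false.
    by apply: contraNF b2 => /eqP e; rewrite mulr2n {1}e; apply/eqP; ring.
  by apply/tuple_uniqP; rewrite /= !inE !xpair_eqE h1 h2 h3 h4 h5 h6 !andbF.
pose M := pmx c k (- w) (- (k / (w * c))) p.
have dep : lam *m M = 0.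
  apply/rowP => j; rewrite !mxE !big_ord_recl big_ord0 !mxE !cd /=.
  case: j => -[|[|[|[|[|[|//]]]]]] lt6 /=; rewrite /height /f0 /f1 /w /=; field; rewrite ?b0 ?b1 ?cN0 ?oppr_eq0 ?oner_neq0 //.
exists <<M>>%MS; rewrite genmxE.
have pts5 : (5 <= npts_on (surface c k (- w) (- (k / (w * c)))) <<M>>%MS)%N.
  by apply: (npts_on_ge p_inj p0) => i; rewrite genmxE -row_pmx row_sub.
split=> //; apply/eqP; rewrite eqn_leq; apply/andP; split.
  rewrite -ltnS ltn_neqAle rank_leq_row andbT; apply/negP => fM.
  have /rowP/(_ 1) : lam = 0.
    by apply/eqP; rewrite -submx0; move/sub_kermxP: dep; rewrite (_ : kermx M = 0) //; apply/eqP; rewrite kermx_eq0.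
  by rewrite !mxE /= => /eqP; rewrite oppr_eq0 expf_eq0 (negPf b0).
(* Rank at most 3 would put five points in a plane, against [surface_plane]. *)
rewrite leqNgt ltnS -(genmxE M); apply/negP => r3.
by have := leq_trans pts5 (surface_plane n_rl k_rl r3).
Qed.

End Existence.

Theorem mainTheorem12 (q : nat)
  (hq : exists p k : nat, [/\ prime p, (0 < k)%N & q = (p ^ k)%N])
  (hq4 : (4 <= q)%N)
  (F : finFieldType) (hF : #|F| = q) :
  exists X : {set 'rV[F]_5},
    #|X| = (q ^ 2 - q)%N /\ k_general_set 4 X /\ rs_set 5 3 X.
Proof.
rewrite -hF in hq4 *.
have [c c1 n_rl] := ex_quadratic_rootless hq4.
have cN0 : c != 0 by have := n_rl 0; rewrite expr0n /= !add0r.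
have [u [u0 d0 s0]] := ex_scale hq4 c1 n_rl.
(* This choice makes b + 1 = c u^2 b, so that w c is the square required by [ex_cubic_rootless]. *)
pose b := (c * u ^+ 2 - 1)^-1.
have b0 : b != 0 by rewrite invr_eq0.
have b1E : b + 1 = c * u ^+ 2 * b by rewrite /b; field.
have b1 : b + 1 != 0 by rewrite b1E !mulf_neq0 ?expf_neq0.
have b2 : b *+ 2 + 1 != 0.
  by have -> : b *+ 2 + 1 = (c * u ^+ 2 + 1) * b; [rewrite /b; field|rewrite mulf_neq0].
pose w := b * (b + 1).
have wN0 : w != 0 by rewrite mulf_neq0.
have wc : w * c = (c * u * b) ^+ 2 by rewrite /w b1E; ring.
have z0 : c * u * b != 0 by rewrite !mulf_neq0.
have [k k_rl] := ex_cubic_rootless c1 wN0 z0 wc.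
have [U4 [rU4 U4_5]] := five_points_dependent n_rl b0 b1 b2 k_rl.
exists (surface c k (- w) (- (k / (w * c)))); split; first exact: card_surface.
split; split.
- by move=> U rU; apply: (surface_plane n_rl k_rl); rewrite rU.
- exact: surface_span.
(* The same solid serves twice: it is the five-point witness here, and below the seven-point
   hyperplane is found through it. *)
- by exists U4.
- by move=> U rU; apply: (surface_solid n_rl k_rl); rewrite rU.
- exact: surface_span.
- by apply: (hyperplane_seven_points hq4 n_rl k_rl rU4).
Qed.
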